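(* Let $X\in G$ and $Y,Z\in USS(X)$ with $\ell(Y)>0$. Then there is an oriented path $(b_1,\ldots,b_t,g_1,\ldots,g_s)$ in $\Gamma_X$ from $Y$ to $Z$ such that $(b_1,\ldots,b_t)$ is a (possibly empty) black path and $(g_1,\ldots,g_s)$ is a (possibly empty) grey path. Moreover, if $Z=Y^\alpha$ with $\alpha\in P$, the path can be chosen so that $b_1\cdots b_t g_1\cdots g_s=\alpha$.
   Context: $G$ is a Garside group: it has a lattice order $\preccurlyeq$ invariant under left multiplication ($a\preccurlyeq b$ iff $a^{-1}b\in P$, where $P=\{p\in G:1\preccurlyeq p\}$), with meet $\wedge$; there is a Garside element $\Delta\in P$ such that $[1,\Delta]$ is finite and generates $G$ and $\Delta^{-1}P\Delta=P$; and $P$ is atomic. Elements of $[1,\Delta]$ are simple. $\tau(x)=\Delta^{-1}x\Delta$; $X^a=a^{-1}Xa$. Left normal form $X=\Delta^p x_1\cdots x_r$: $p$ maximal with $\Delta^p\preccurlyeq X$, each $x_i\neq 1$ the maximal simple prefix of $x_i\cdots x_r$; $\inf X=p$, $\sup X=p+r$, $\ell(X)=r$. $\iota(X)=\tau^{-p}(x_1)$ if $r>0$, $\iota(\Delta^p)=1$. $\mathbf c(X)=X^{\iota(X)}$. $SSS(X)$: conjugates of $X$ of maximal infimum and minimal supremum; $USS(X)$: those $Y\in SSS(X)$ with $\mathbf c^m(Y)=Y$ for some $m>0$. A minimal simple element for $Y\in USS(X)$ is a simple $s\neq1$ with $Y^s\in USS(X)$ such that no prefix $t\ne1$, $t\neq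 s$ of $s$ has $Y^t\in USS(X)$. $\Gamma_X$ is the directed graph with vertex set $USS(X)$ and an arrow labeled $s$ from $Y$ to $Y^s$ for each $Y\in USS(X)$ and each minimal simple element $s$ for $Y$. An arrow $s$ starting at $Y$ is black if $s\preccurlyeq\iota(Y)$ and grey if $s\preccurlyeq\iota(Y^{-1})$. An oriented path is a sequence of arrows, each starting at the endpoint of the previous one; it is black (grey) if all its arrows are black (grey). *)

(* Defs.v *)
From Stdlib Require Import ZArith List ClassicalEpsilon.
Import ListNotations.
Set Implicit Arguments.
Unset Strict Implicit.

(** A Garside group: a group G with positive cone P (1 ∈ P, P·P ⊆ P,
    P ∩ P^{-1} = {1}), so that a ≼ b :⇔ a^{-1}b ∈ P is a partial order,
    invariant under left multiplication; ≼ is a lattice; Δ ∈ P, the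
    interval [1,Δ] is finite and generates G, Δ^{-1}PΔ = P, P atomic. *)
Record GarsideGroup := {
  carrier :> Type;
  mul : carrier -> carrier -> carrier;
  one : carrier;
  inv : carrier -> carrier;
  Pos : carrier -> Prop;
  Delta : carrier;
  mulA : forall a b c, mul a (mul b c) = mul (mul a b) c;
  mul1g : forall a, mul one a = a;
  mulg1 : forall a, mul a one = a;
  mulVg : forall a, mul (inv a) a = one;
  mulgV : forall a, mul a (inv a) = one;
  pos_one : Pos one;
  pos_mul : forall a b, Pos a -> Pos b -> Pos (mul a b);
  pos_antisym : forall a, Pos a -> Pos (inv a) -> a = one;
  meet_ex : forall a b, exists m,
      Pos (mul (inv m) a) /\ Pos (mul (inv m) b) /\
      forall c, Pos (mul (inv c) a) -> Pos (mul (inv c) b) -> Pos (mul (inv c) m);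
  join_ex : forall a b, exists j,
      Pos (mul (inv a) j) /\ Pos (mul (inv b) j) /\
      forall c, Pos (mul (inv a) c) -> Pos (mul (inv b) c) -> Pos (mul (inv j) c);
  delta_pos : Pos Delta;
  simples_finite : exists l : list carrier, forall s,
      Pos s -> Pos (mul (inv s) Delta) -> In s l;
  simples_generate : forall g, exists l : list (bool * carrier),
      (forall bs, In bs l -> Pos (snd bs) /\ Pos (mul (inv (snd bs)) Delta)) /\
      g = fold_right (fun (bs : bool * carrier) acc =>
             mul (if fst bs then snd bs else inv (snd bs)) acc) one l;
  delta_conj : forall p, Pos p <-> Pos (mul (mul (inv Delta) p) Delta);
  atomic : forall a, Pos a -> exists N : nat, forall l : list carrier,
      (forall x, In x l -> Pos x /\ x <> one) ->
      fold_right mul one l = a -> length l <= N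
}.

Section Garside.
Variable G : GarsideGroup.
Local Notation mul := (@mul G).
Local Notation one := (@one G).
Local Notation inv := (@inv G).
Local Notation Delta := (@Delta G).

Definition prec (a b : G) : Prop := @Pos G (mul (inv a) b).
Definition simple (s : G) : Prop := prec one s /\ prec s Delta.

Definition gprod (l : list G) : G := fold_right mul one l.

Fixpoint pown (a : G) (n : nat) : G :=
  match n with O => one | S n => mul a (pown a n) end.

Definition powZ (a : G) (z : Z) : G :=
  match z with
  | Z0 => one
  | Zpos n => pown a (Pos.to_nat n)
  | Zneg n => inv (pown a (Pos.to_nat n))
  end.

Definition conj (X a : G) : G := mul (mul (inv a) X) a.

Definition tauZ (k : Z) (x : G) : G := conj x (powZ Delta k).

Definition is_lnf (X : G) (p : Z) (xs : list G) : Prop :=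
  X = mul (powZ Delta p) (gprod xs) /\
  prec (powZ Delta p) X /\
  (forall q, prec (powZ Delta q) X -> (q <= p)%Z) /\
  forall i, i < length xs ->
    nth i xs one <> one /\
    simple (nth i xs one) /\
    prec (nth i xs one) (gprod (skipn i xs)) /\
    (forall s, simple s -> prec s (gprod (skipn i xs)) -> prec s (nth i xs one)).

(** the left normal form (chosen by ε; it exists and is unique in a
    Garside group) *)
Definition lnf (X : G) : Z * list G :=
  epsilon (inhabits (0%Z, @nil G)) (fun pr => is_lnf X (fst pr) (snd pr)).

Definition inf (X : G) : Z := fst (lnf X).
Definition ell (X : G) : nat := length (snd (lnf X)).
Definition sup (X : G) : Z := (inf X + Z.of_nat (ell X))%Z.

Definition iota (X : G) : G :=
  match snd (lnf X) with
  | nil => one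
  | x1 :: _ => tauZ (- inf X) x1
  end.

Definition cyc (X : G) : G := conj X (iota X).

Definition SSS (X Y : G) : Prop :=
  (exists a, Y = conj X a) /\
  (forall a, (inf (conj X a) <= inf Y)%Z) /\
  (forall a, (sup Y <= sup (conj X a))%Z).

Definition USS (X Y : G) : Prop :=
  SSS X Y /\ exists m, 0 < m /\ Nat.iter m cyc Y = Y.

Definition minimal_simple (X Y s : G) : Prop :=
  simple s /\ s <> one /\ USS X (conj Y s) /\
  forall t, prec one t -> prec t s -> t <> one -> t <> s -> ~ USS X (conj Y t).

Definition arrow (X Y s : G) : Prop := USS X Y /\ minimal_simple X Y s.

Inductive black_path (X : G) : G -> list G -> G -> Prop :=
| black_nil Y : black_path X Y nil Y
| black_cons Y s l Z :
    arrow X Y s -> prec s (iota Y) ->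
    black_path X (conj Y s) l Z -> black_path X Y (s :: l) Z.

Inductive grey_path (X : G) : G -> list G -> G -> Prop :=
| grey_nil Y : grey_path X Y nil Y
| grey_cons Y s l Z :
    arrow X Y s -> prec s (iota (inv Y)) ->
    grey_path X (conj Y s) l Z -> grey_path X Y (s :: l) Z.

End Garside.

(* Main.v *)
Require Import Defs.
From Stdlib Require Import ZArith List Lia Classical ClassicalEpsilon.
Import ListNotations.

(** Write [a ∧ b] for [meet a b], and let [Y] have infimum [p]. For [a] conjugating
    [Y] into its super summit set, [a ι(Y^a) = Y a Δ^-p ∧ a Δ] is a monotone function
    of [a] that preserves meets; iterating it and using the finiteness of [[1, Δ^k]]
    gives that conjugators between elements of the ultra summit set are closed
    under meets.

    Given [Y^α] in the ultra summit set, black arrows are followed as long as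
    [α ∧ ι(Y) ≠ 1]. Once [α ∧ ι(Y) = 1], the prefix [g = α ∧ Δ] satisfies [g ≼ ι(Y^-1)],
    so it splits into grey arrows; moreover [g ι(Y^g) ≼ g Δ ∧ ι(Y) Δ = Δ], which forces
    [g^-1 α ∧ ι(Y^g) = 1], so no black arrow is ever needed again. *)

Set Implicit Arguments.
Unset Strict Implicit.

Section Garside.
Context (G : GarsideGroup).

Declare Scope garside_scope.
Delimit Scope garside_scope with gar.
Local Open Scope garside_scope.
Local Notation "1" := (@one G) : garside_scope.
Local Notation "a * b" := (@mul G a b) : garside_scope.
Local Notation "a ^-1" := (@inv G a) (at level 3, left associativity, format "a ^-1") : garside_scope.
Local Notation "a <<= b" := (@prec G a b) (at level 70) : garside_scope.
Local Notation "'Δ'" := (@Delta G) : garside_scope.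
Local Notation D z := (powZ (@Delta G) z%Z).
Implicit Types a b c d g s t u v x y W X Y Z : G.

(** * Group identities, the prefix order and its meets *)

Lemma mulgA a b c : (a * b) * c = a * (b * c).
Proof. symmetry; apply mulA. Qed.
Lemma mulKg a b : a^-1 * (a * b) = b.
Proof. now rewrite mulA, mulVg, mul1g. Qed.
Lemma mulKVg a b : a * (a^-1 * b) = b.
Proof. now rewrite mulA, mulgV, mul1g. Qed.
Lemma mulgI a b c : a * b = a * c -> b = c.
Proof. intros H; rewrite <- (mulKg a b), H; apply mulKg. Qed.
Lemma invg_unique a b : a * b = 1 -> b = a^-1.
Proof. intros H; apply (@mulgI a); now rewrite H, mulgV. Qed.
Lemma invgK a : (a^-1)^-1 = a.
Proof. symmetry; apply invg_unique, mulVg. Qed.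
Lemma invgM a b : (a * b)^-1 = b^-1 * a^-1.
Proof.
symmetry; apply invg_unique.
now rewrite mulgA, mulKVg, mulgV.
Qed.
Lemma invg1 : (1)^-1 = 1.
Proof. symmetry; apply invg_unique, mul1g. Qed.

Hint Rewrite mulgA mul1g mulg1 mulVg mulgV mulKg mulKVg invgK invgM invg1 : grp.
Ltac grp := unfold conj; autorewrite with grp; try reflexivity.

Lemma conj1 Y : conj Y 1 = Y.
Proof. grp. Qed.
Lemma conjM Y a b : conj (conj Y a) b = conj Y (a * b).
Proof. grp. Qed.
Lemma conj_inv Y a : conj (Y^-1) a = (conj Y a)^-1.
Proof. grp. Qed.

Lemma prec_eq a b a' b' : a^-1 * b = a'^-1 * b' -> a <<= b -> a' <<= b'.
Proof. unfold prec; now intros ->. Qed.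
Lemma prec_refl a : a <<= a.
Proof. unfold prec; rewrite mulVg; apply pos_one. Qed.
Lemma prec_trans a b c : a <<= b -> b <<= c -> a <<= c.
Proof.
unfold prec; intros H K.
replace (a^-1 * c) with ((a^-1 * b) * (b^-1 * c)) by grp.
now apply pos_mul.
Qed.
Lemma prec_antisym a b : a <<= b -> b <<= a -> a = b.
Proof.
unfold prec; intros H K.
assert (E : b^-1 * a = 1).
{ apply pos_antisym; trivial; now replace ((b^-1 * a)^-1) with (a^-1 * b) by grp. }
now rewrite <- (mulKVg b a), E, mulg1.
Qed.
Lemma prec_mull c a b : a <<= b -> c * a <<= c * b.
Proof. apply prec_eq; grp. Qed.
Lemma prec1_pos a : 1 <<= a <-> Pos a.
Proof. unfold prec; now rewrite invg1, mul1g. Qed.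
Lemma prec_mulr a b : Pos b -> a <<= a * b.
Proof. unfold prec; now rewrite mulKg. Qed.
Lemma prec_factor a b : a <<= b -> Pos (a^-1 * b).
Proof. trivial. Qed.

Definition meet a b : G :=
  proj1_sig (constructive_indefinite_description _ (meet_ex a b)).

Lemma meet_l a b : meet a b <<= a.
Proof. unfold meet; destruct constructive_indefinite_description as [m H]; apply H. Qed.
Lemma meet_r a b : meet a b <<= b.
Proof. unfold meet; destruct constructive_indefinite_description as [m H]; apply H. Qed.
Lemma meet_glb a b c : c <<= a -> c <<= b -> c <<= meet a b.
Proof. unfold meet; destruct constructive_indefinite_description as [m H]; apply H. Qed.
Lemma meet_mull c a b : c * meet a b = meet (c * a) (c * b).
Proof.
apply prec_antisym.
- apply meet_glb; apply prec_mull; [apply meet_l | apply meet_r].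
- apply (@prec_eq (c^-1 * meet (c * a) (c * b)) (meet a b)); [grp|].
  apply meet_glb; [apply (@prec_eq (meet (c * a) (c * b)) (c * a)) | apply (@prec_eq (meet (c * a) (c * b)) (c * b))];
    first [apply meet_l | apply meet_r | grp].
Qed.
Lemma meet_pos a b : Pos a -> Pos b -> Pos (meet a b).
Proof. rewrite <- !prec1_pos; apply meet_glb. Qed.

(** * Powers of [Delta] *)

Lemma powZ_of_nat a n : powZ a (Z.of_nat n) = pown a n.
Proof. destruct n; simpl; trivial; now rewrite SuccNat2Pos.id_succ. Qed.
Lemma powZ_opp_nat a n : powZ a (- Z.of_nat n) = (pown a n)^-1.
Proof. destruct n; simpl; [now rewrite invg1|now rewrite SuccNat2Pos.id_succ]. Qed.
Lemma pown_comm a n : pown a n * a = a * pown a n.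
Proof. induction n; simpl; grp; now rewrite IHn. Qed.
Lemma powZ_succ a z : powZ a (Z.succ z) = powZ a z * a.
Proof.
destruct (Z_le_gt_dec 0 z) as [H|H].
- rewrite <- (Z2Nat.id z H), <- Nat2Z.inj_succ, !powZ_of_nat.
  symmetry; apply pown_comm.
- pose (n := Z.to_nat (- Z.succ z)).
  assert (E : z = (- Z.of_nat (S n))%Z) by lia.
  replace (Z.succ z) with (- Z.of_nat n)%Z by lia.
  rewrite E, !powZ_opp_nat; simpl; grp.
Qed.
Lemma powZ_pred a z : powZ a (Z.pred z) = powZ a z * a^-1.
Proof. rewrite <- (Z.succ_pred z) at 2; rewrite powZ_succ; grp. Qed.
Lemma powZ_add a m n : powZ a (m + n) = powZ a m * powZ a n.
Proof.
induction n using Z.peano_ind.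
- rewrite Z.add_0_r; simpl; grp.
- rewrite Z.add_succ_r, !powZ_succ, IHn; grp.
- rewrite Z.add_pred_r, !powZ_pred, IHn; grp.
Qed.
Lemma powZ_opp a z : powZ a (- z) = (powZ a z)^-1.
Proof. apply invg_unique; rewrite <- powZ_add; now rewrite Z.add_opp_diag_r. Qed.
Lemma powZ_1 a : powZ a 1 = a.
Proof. simpl; apply mulg1. Qed.

Lemma pos_D z a : Pos a <-> Pos (conj a (D z)).
Proof.
induction z using Z.peano_ind.
- now rewrite conj1.
- rewrite IHz, powZ_succ, <- (conjM a (D z)); apply delta_conj.
- rewrite IHz, powZ_pred, <- (conjM a (D z)).
  rewrite (delta_conj (conj (conj a (D z)) Δ^-1)).
  fold (conj (conj (conj a (D z)) Δ^-1) Δ).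
  rewrite (conjM (conj a (D z))), mulVg, conj1; tauto.
Qed.
Lemma prec_D z a b : a * D z <<= b * D z <-> a <<= b.
Proof.
unfold prec; rewrite (pos_D z (a^-1 * b)).
now replace ((a * D z)^-1 * (b * D z)) with (conj (a^-1 * b) (D z)) by grp.
Qed.
Lemma prec_Delta a b : a * Δ <<= b * Δ <-> a <<= b.
Proof. rewrite <- (powZ_1 Δ); apply prec_D. Qed.
Lemma meet_D z a b : meet a b * D z = meet (a * D z) (b * D z).
Proof.
apply prec_antisym.
- apply meet_glb; apply prec_D; [apply meet_l | apply meet_r].
- apply (@prec_D (-z)); rewrite powZ_opp.
  replace (meet a b * D z * (D z)^-1) with (meet a b) by grp.
  apply meet_glb; apply (@prec_D z); grp; [apply meet_l | apply meet_r].
Qed.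
Lemma meet_Delta a b : meet a b * Δ = meet (a * Δ) (b * Δ).
Proof. generalize (meet_D 1 a b); now rewrite (powZ_1 Δ). Qed.
Lemma D_le m n : (m <= n)%Z -> D m <<= D n.
Proof.
intros H; unfold prec; rewrite <- powZ_opp, <- powZ_add.
rewrite <- (Z2Nat.id (- m + n)), powZ_of_nat by lia.
induction (Z.to_nat (- m + n)); simpl; [apply pos_one | apply pos_mul; trivial; apply delta_pos].
Qed.
Lemma prec_mulD a b m n : D m <<= a -> D n <<= b -> D (m + n) <<= a * b.
Proof.
intros H K; rewrite powZ_add; apply (@prec_trans _ (a * D n)).
- now apply prec_D.
- now apply prec_mull.
Qed.
Lemma prec_mulD' a b m n : a <<= D m -> b <<= D n -> a * b <<= D (m + n).
Proof.
intros H K; rewrite powZ_add; apply (@prec_trans _ (a * D n)).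
- now apply prec_mull.
- now apply prec_D.
Qed.
(** Simple elements generate, and each letter [s] or [s^-1] lies between [D (-1)] and [D 1]; such
    bounds add up along a word. *)
Lemma bounded_D g : exists n, D (- n) <<= g /\ g <<= D n.
Proof.
destruct (simples_generate g) as [l [Hl ->]].
induction l as [|[[] s] l IH]; simpl.
- exists 0%Z; split; apply prec_refl.
- destruct IH as [n [H1 H2]]; [intros; apply Hl; now right|].
  destruct (Hl (true, s)) as [P1 P2]; [now left|]; simpl in *.
  exists (1 + n)%Z; split.
  + replace (- (1 + n))%Z with (-1 + -n)%Z by lia.
    apply prec_mulD; trivial.
    apply (@prec_trans _ (D 0)); [apply D_le; lia | now apply prec1_pos].
  + apply prec_mulD'; trivial; now rewrite powZ_1.
- destruct IH as [n [H1 H2]]; [intros; apply Hl; now right|].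
  destruct (Hl (false, s)) as [P1 P2]; [now left|]; simpl in *.
  exists (1 + n)%Z; split.
  + replace (- (1 + n))%Z with (-1 + -n)%Z by lia.
    apply prec_mulD; trivial.
    apply (@prec_D 1); change (D (-1)) with (D (Z.opp 1)); rewrite powZ_opp, powZ_1, mulVg.
    now apply prec1_pos.
  + apply prec_mulD'; trivial.
    apply (@prec_trans _ 1); [|apply prec1_pos; rewrite powZ_1; apply delta_pos].
    unfold prec; now rewrite invgK, mulg1.
Qed.
Lemma bounded_Dnat a : exists n : nat, a <<= D (Z.of_nat n).
Proof.
destruct (bounded_D a) as [z [_ H]]; exists (Z.to_nat z).
apply (@prec_trans _ _ _ H), D_le; lia.
Qed.

(** Settles the degenerate case: every element lies between two powers of [Δ]. *)
Lemma Delta_trivial : Δ = 1 -> forall g, g = 1.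
Proof.
intros E.
assert (H : forall z, D z = 1).
{ intros z; rewrite E; induction z using Z.peano_ind;
  [reflexivity | rewrite powZ_succ, IHz; grp | rewrite powZ_pred, IHz; grp]. }
intros g; destruct (bounded_D g) as [n [H1 H2]]; rewrite H in *.
now apply prec_antisym.
Qed.

(** * Heads [a ∧ Δ] and finite intervals *)

Lemma prec1_eq a : Pos a -> a <<= 1 -> a = 1.
Proof. intros H K; apply prec_antisym; trivial; now apply prec1_pos. Qed.

(** If [a ∧ Δ = 1], then [a ∧ D (n+1) ≼ (a ∧ Δ) D n = D n], so by induction [a ∧ D n ≼ 1] for all
    [n]; but [a] lies below some [D n]. *)
Lemma pos_meet_Delta_neq1 a : Pos a -> a <> 1 -> meet a Δ <> 1.
Proof.
intros P N H; apply N, prec1_eq; trivial.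
assert (K : forall n, meet a (D (Z.of_nat n)) <<= 1).
{ induction n.
  - apply meet_r.
  - refine (prec_trans _ IHn); apply meet_glb; [apply meet_l|].
    rewrite <- (mul1g (D (Z.of_nat n))), <- H, meet_D.
    rewrite Nat2Z.inj_succ, <- Z.add_1_l, powZ_add, powZ_1.
    apply meet_glb; [|apply meet_r].
    apply (prec_trans (meet_l _ _)), prec_mulr, prec1_pos.
    apply (@D_le 0); lia. }
destruct (bounded_Dnat a) as [n Hn].
refine (prec_trans _ (K n)); apply meet_glb; trivial; apply prec_refl.
Qed.

Lemma prec_mul_meet_D a n :
  Pos a -> a <<= D (Z.of_nat (S n)) -> a <<= meet a Δ * D (Z.of_nat n).
Proof.
intros P H; rewrite meet_D; apply meet_glb.
- apply prec_mulr, prec1_pos, (@D_le 0); lia.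
- now rewrite Nat2Z.inj_succ, <- Z.add_1_l, powZ_add, powZ_1 in H.
Qed.

(** Splitting off the simple head [a ∧ Δ] leaves a remainder in the interval for [n - 1], so
    finitely many products cover the interval. *)
Lemma interval_finite n :
  exists l, forall a, Pos a -> a <<= D (Z.of_nat n) -> In a l.
Proof.
induction n as [|n [l Hl]].
- exists [1]; intros a P H; left; symmetry; now apply prec1_eq.
- destruct (simples_finite G) as [ls Hs].
  exists (flat_map (fun s => map (mul s) l) ls); intros a P H.
  apply in_flat_map; exists (meet a Δ); split.
  + apply Hs; [apply meet_pos; trivial; apply delta_pos|apply meet_r].
  + apply in_map_iff; exists ((meet a Δ)^-1 * a); split; [grp|].
    apply Hl; [apply meet_l|].
    apply (@prec_eq a (meet a Δ * D (Z.of_nat n))); [grp|].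
    now apply prec_mul_meet_D.
Qed.

Lemma pigeonhole (T : Type) (f : nat -> T) (l : list T) :
  (forall n, In (f n) l) -> exists i j, i < j /\ f i = f j.
Proof.
intros H; apply NNPP; intros N.
assert (K : NoDup (map f (seq 0 (S (length l))))).
{ apply NoDup_map_NoDup_ForallPairs; [|apply seq_NoDup].
  intros i j _ _ E; destruct (Nat.lt_trichotomy i j) as [L|[L|L]]; trivial;
  destruct N; eauto. }
apply NoDup_incl_length with (l' := l) in K.
- rewrite length_map, length_seq in K; lia.
- intros x; rewrite in_map_iff; now intros [i [<- _]].
Qed.

(** * Lengths of decompositions of positive elements *)

(** Atomicity provides such a bound for each positive element. It is the induction measure below,
    dropping by one whenever a nontrivial positive factor is removed. *)
Definition decomp_le n a := forall l,
  (forall x, In x l -> Pos x /\ x <> 1) -> gprod l = a -> length l <= n.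

Lemma decomp_le0 a : Pos a -> decomp_le 0 a -> a = 1.
Proof.
intros P H; apply NNPP; intros N.
enough (length [a] <= 0) by (simpl in *; lia).
apply H; [intros x [<-|[]]; tauto | apply mulg1].
Qed.
Lemma decomp_le_r n a b : Pos a -> a <> 1 -> decomp_le (S n) (a * b) -> decomp_le n b.
Proof.
intros P N H l Hl E; apply le_S_n, (H (a :: l)); [|simpl; now rewrite E].
intros x [<-|I]; auto.
Qed.
Lemma gprod_app l l' : gprod (l ++ l') = gprod l * gprod l'.
Proof. induction l; simpl; grp; now rewrite IHl. Qed.
Lemma decomp_le_l n a b : Pos b -> b <> 1 -> decomp_le (S n) (a * b) -> decomp_le n a.
Proof.
intros P N H l Hl E; apply le_S_n.
replace (S (length l)) with (length (l ++ [b])) by (rewrite length_app; simpl; lia).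
apply H; [|rewrite gprod_app, E; simpl; grp].
intros x; rewrite in_app_iff; intros [I|[<-|[]]]; auto.
Qed.
Lemma decomp_le_factor n a s : Pos s -> s <> 1 -> decomp_le (S n) a -> decomp_le n (s^-1 * a).
Proof. intros P N H; apply (@decomp_le_r n s); trivial; now rewrite mulKVg. Qed.

(** * Left normal forms *)

Definition normal (xs : list G) := forall i, i < length xs ->
    nth i xs 1 <> 1 /\
    simple (nth i xs 1) /\
    nth i xs 1 <<= gprod (skipn i xs) /\
    (forall s, simple s -> s <<= gprod (skipn i xs) -> s <<= nth i xs 1).

Lemma normal_pos xs : normal xs -> Pos (gprod xs).
Proof.
induction xs as [|x xs IH]; intros H; simpl; [apply pos_one|apply pos_mul].
- apply prec1_pos; destruct (H 0) as [_ [[K _] _]]; simpl in *; trivial; lia.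
- apply IH; intros i Hi; apply (H (S i)); simpl; lia.
Qed.

Lemma normal_head x xs : normal (x :: xs) -> x = meet (gprod (x :: xs)) Δ.
Proof.
intros H; generalize (normal_pos H); intros P.
destruct (H 0) as [_ [[_ Q] [L M]]]; simpl in *; [lia|].
apply prec_antisym; [now apply meet_glb|].
apply M; [split; [apply prec1_pos, meet_pos; trivial; apply delta_pos|apply meet_r]|apply meet_l].
Qed.

(** Greedy construction: the head is [a ∧ Δ], nontrivial while [a] is. *)
Lemma normal_exists n a : Pos a -> decomp_le n a -> exists xs, gprod xs = a /\ normal xs.
Proof.
revert a; induction n; intros a P H.
- exists nil; split; [symmetry; now apply decomp_le0 | intros i; simpl; lia].
- destruct (classic (a = 1)) as [->|N]; [exists nil; split; [trivial|intros i; simpl; lia]|].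
  assert (Pm : Pos (meet a Δ)) by (apply meet_pos; trivial; apply delta_pos).
  destruct (IHn ((meet a Δ)^-1 * a)) as [xs [E Hx]].
  + apply meet_l.
  + apply decomp_le_factor; trivial; now apply pos_meet_Delta_neq1.
  + exists (meet a Δ :: xs).
    assert (E' : gprod (meet a Δ :: xs) = a) by (simpl; rewrite E; grp).
    split; [trivial|].
    intros [|i] Hi; [|apply Hx; simpl in Hi; lia].
    change (skipn 0 (meet a Δ :: xs)) with (meet a Δ :: xs); rewrite E'; simpl.
    split; [now apply pos_meet_Delta_neq1|]; split; [split; [now apply prec1_pos | apply meet_r]|].
    split; [apply meet_l|]; intros s [_ Hs] K; now apply meet_glb.
Qed.

(** A normal head is the meet with [Δ], so removing it from an element below [D (n+1)] leaves one
    below [D n]. *)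
Lemma normal_length xs n : normal xs -> gprod xs <<= D (Z.of_nat n) -> length xs <= n.
Proof.
revert n; induction xs as [|x xs IH]; intros n H K; simpl; [lia|].
generalize (normal_pos H) (normal_head H); intros P E.
destruct n.
- destruct (H 0) as [C [_ [L _]]]; [simpl; lia|]; destruct C; simpl nth in *.
  apply prec1_eq; [|now apply (prec_trans L)].
  rewrite E; apply meet_pos; trivial; apply delta_pos.
- apply le_n_S, IH; [intros i Hi; apply (H (S i)); simpl; lia|].
  apply prec_mul_meet_D in K; trivial; rewrite <- E in K.
  now apply (@prec_eq (gprod (x :: xs)) (x * D (Z.of_nat n))); [simpl; grp|].
Qed.

Lemma normal_length_prec xs : normal xs -> gprod xs <<= D (Z.of_nat (length xs)).
Proof.
induction xs as [|x xs IH]; intros H; [apply prec_refl|].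
simpl length; rewrite Nat2Z.inj_succ, <- Z.add_1_l; simpl gprod; apply prec_mulD'.
- rewrite powZ_1; destruct (H 0) as [_ [[_ Q] _]]; simpl in *; trivial; lia.
- apply IH; intros i Hi; apply (H (S i)); simpl; lia.
Qed.

Context (nontriv : Δ <> 1).

Lemma D_le_iff m n : D m <<= D n <-> (m <= n)%Z.
Proof.
split; [|apply D_le]; intros H; apply Z.nlt_ge; intros L.
apply nontriv, prec1_eq; [apply delta_pos|].
apply (@prec_D (m - 1)); rewrite mul1g.
rewrite <- (powZ_1 Δ) at 1; rewrite <- powZ_add.
apply (@prec_trans _ (D m)); [|apply (prec_trans H)]; apply D_le; lia.
Qed.

Lemma inf_exists X : exists p, D p <<= X /\ forall q, D q <<= X -> (q <= p)%Z.
Proof.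
destruct (bounded_D X) as [n [H1 H2]].
apply NNPP; intros N.
assert (K : forall k : nat, D (- n + Z.of_nat k) <<= X).
{ induction k; [now rewrite Z.add_0_r|].
  apply NNPP; intros C; apply N; exists (- n + Z.of_nat k)%Z; split; trivial.
  intros q Hq; apply Z.nlt_ge; intros L; apply C.
  apply (@prec_trans _ (D q)); trivial; apply D_le; lia. }
(* The exponent [-n + (2n + 1)] exceeds the upper bound [n]. *)
specialize (K (Z.to_nat (2 * n + 1))); apply prec_trans with (2 := H2) in K.
apply D_le_iff in K; lia.
Qed.

Lemma lnf_spec X : is_lnf X (inf X) (snd (lnf X)).
Proof.
unfold inf, lnf.
apply (epsilon_spec (inhabits (0%Z, @nil G)) (fun pr => is_lnf X (fst pr) (snd pr))).
destruct (inf_exists X) as [p [H1 H2]].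
destruct (@atomic G ((D p)^-1 * X) H1) as [n Hn].
destruct (@normal_exists n ((D p)^-1 * X)) as [xs [E Hx]]; trivial.
exists (p, xs); simpl; split; [rewrite E; grp | auto].
Qed.

Lemma prec_inf X q : D q <<= X <-> (q <= inf X)%Z.
Proof.
destruct (lnf_spec X) as [_ [H1 [H2 _]]]; split; [apply H2|].
intros L; apply (@prec_trans _ (D (inf X))); trivial; now apply D_le.
Qed.

(** By [normal_length] and [normal_length_prec], the number of normal factors is the least [n] for
    which their product lies below [D n]. *)
Lemma prec_sup X q : X <<= D q <-> (sup X <= q)%Z.
Proof.
unfold sup, ell; destruct (lnf_spec X) as [E [_ [_ H]]].
fold (normal (snd (lnf X))) in H.
revert E H; generalize (snd (lnf X)) (inf X); intros xs p -> H; split; intros K.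
- assert (L : gprod xs <<= D (q - p)).
  { apply (@prec_eq (D p * gprod xs) (D q)); trivial.
    unfold Z.sub; rewrite Z.add_comm, powZ_add, powZ_opp; grp. }
  destruct (Z_le_gt_dec 0 (q - p)) as [M|M].
  + rewrite <- (Z2Nat.id (q - p)) in L by trivial.
    apply normal_length in L; trivial; lia.
  + assert (C : D 0 <<= D (q - p)).
    { apply (@prec_trans _ (gprod xs)); trivial; now apply prec1_pos, normal_pos. }
    apply D_le_iff in C; lia.
- apply (@prec_trans _ (D (p + Z.of_nat (length xs)))); [|now apply D_le].
  rewrite powZ_add; apply prec_mull; now apply normal_length_prec.
Qed.

(** Eliminates normal forms from later arguments about [iota]. The head [x1] is the meet of the
    factors' product with [Δ]; conjugation by a power of [Δ] preserves meets and fixes [Δ]. *)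
Lemma iota_meet X : iota X = meet (X * D (- inf X)) Δ.
Proof.
unfold iota, tauZ; destruct (lnf_spec X) as [E [_ [_ H]]].
fold (normal (snd (lnf X))) in H.
revert E H; generalize (snd (lnf X)) (inf X); intros xs p -> H.
assert (C : D p * Δ * D (- p) = Δ).
{ rewrite <- powZ_succ, <- powZ_add.
  replace (Z.succ p + - p)%Z with 1%Z by lia; apply powZ_1. }
destruct xs as [|x xs]; simpl gprod.
- rewrite mulg1, powZ_opp, mulgV; apply prec_antisym; [|apply meet_l].
  apply meet_glb; [apply prec_refl|apply prec1_pos, delta_pos].
- rewrite (normal_head H) at 1; unfold conj.
  rewrite powZ_opp, invgK, meet_mull, <- powZ_opp, meet_D, C; reflexivity.
Qed.

Lemma inf_inv X : inf (X^-1) = (- sup X)%Z.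
Proof.
assert (K : forall q, (q <= inf (X^-1))%Z <-> (q <= - sup X)%Z).
{ intros q; rewrite <- prec_inf.
  assert (C : (q <= - sup X)%Z <-> (sup X <= - q)%Z) by (split; lia).
  rewrite C, <- prec_sup.
  rewrite <- (@prec_D (-q) (D q)), <- powZ_add, Z.add_opp_diag_r.
  split; intros H.
  - apply (@prec_eq 1 (X^-1 * D (-q))); trivial; grp.
  - apply (@prec_eq X (D (-q))); trivial; simpl; grp. }
generalize (K (inf (X^-1))) (K (- sup X)%Z); lia.
Qed.

(** * Super summit sets *)

Lemma SSS_inf X Y W : SSS X Y -> SSS X W -> inf W = inf Y.
Proof.
intros [[a ->] [H1 _]] [[b ->] [K1 _]].
generalize (H1 b) (K1 a); lia.
Qed.
Lemma SSS_sup X Y W : SSS X Y -> SSS X W -> sup W = sup Y.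
Proof.
intros [[a ->] [_ H1]] [[b ->] [_ K1]].
generalize (H1 b) (K1 a); lia.
Qed.
Lemma SSS_ell X Y W : SSS X Y -> SSS X W -> ell W = ell Y.
Proof.
intros HY HW; generalize (SSS_inf HY HW) (SSS_sup HY HW); unfold sup; lia.
Qed.

(** Infimum and supremum are constant on the super summit set and extremal there, so two bounds on
    [conj Y a] decide membership. Clearing [a^-1] puts them in a form that is visibly stable under
    meets in [a]. *)
Lemma SSS_conj X Y a : SSS X Y ->
  SSS X (conj Y a) <-> a * D (inf Y) <<= Y * a /\ Y * a <<= a * D (sup Y).
Proof.
intros HY.
transitivity (D (inf Y) <<= conj Y a /\ conj Y a <<= D (sup Y)).
- split.
  + intros HW; rewrite prec_inf, prec_sup, (SSS_inf HY HW), (SSS_sup HY HW); lia.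
  + rewrite prec_inf, prec_sup; intros [L1 L2].
    destruct HY as [[b ->] [H1 H2]]; split; [|split].
    * exists (b * a); now rewrite conjM.
    * intros c; generalize (H1 c); lia.
    * intros c; generalize (H2 c); lia.
- split; intros [K1 K2]; split.
  + revert K1; apply prec_eq; grp.
  + revert K2; apply prec_eq; grp.
  + revert K1; apply prec_eq; grp.
  + revert K2; apply prec_eq; grp.
Qed.

Lemma SSS_meet X Y a b : SSS X Y ->
  SSS X (conj Y a) -> SSS X (conj Y b) -> SSS X (conj Y (meet a b)).
Proof.
intros HY; rewrite !SSS_conj by trivial; intros [A1 A2] [B1 B2].
rewrite !meet_D, meet_mull; split; apply meet_glb.
- now apply (prec_trans (meet_l _ _)).
- now apply (prec_trans (meet_r _ _)).
- now apply (prec_trans (meet_l _ _)).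
- now apply (prec_trans (meet_r _ _)).
Qed.

Lemma SSS_D X Y z : SSS X Y -> SSS X (conj Y (D z)).
Proof.
intros HY; apply SSS_conj; trivial.
rewrite <- !powZ_add, (Z.add_comm z), (Z.add_comm z), !powZ_add, !prec_D.
now rewrite prec_inf, prec_sup.
Qed.

(** [iota Y] is the meet of [Y * D (- inf Y)], which conjugates [Y] as a power of [Δ] does, and
    [Δ]. *)
Lemma SSS_cyc X Y : SSS X Y -> SSS X (cyc Y).
Proof.
intros HY; unfold cyc; rewrite iota_meet; apply SSS_meet; trivial.
- replace (conj Y (Y * D (- inf Y))) with (conj Y (D (- inf Y))) by grp.
  now apply SSS_D.
- rewrite <- (powZ_1 Δ); now apply SSS_D.
Qed.

(** * Transport along cycling *)

(* When [conj Y a] has infimum [p], this is [a * iota (conj Y a)], hence the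
   transport of [a] is [(iota Y)^-1 * shift p Y a]. *)
Definition shift p Y a := meet (Y * a * D (- p)) (a * Δ).

Lemma shift_iota p Y a : inf (conj Y a) = p -> shift p Y a = a * iota (conj Y a).
Proof.
intros <-; rewrite iota_meet, meet_mull; unfold shift; f_equal; grp.
Qed.
Lemma shift_mul p Y a b : shift p Y (a * b) = a * shift p (conj Y a) b.
Proof. unfold shift; rewrite meet_mull; f_equal; grp. Qed.
Lemma shift_mono p Y a b : a <<= b -> shift p Y a <<= shift p Y b.
Proof.
intros H; apply meet_glb.
- apply (prec_trans (meet_l _ _)), prec_D, prec_mull, H.
- apply (prec_trans (meet_r _ _)), prec_Delta, H.
Qed.
Lemma shift_meet p Y a b : shift p Y (meet a b) = meet (shift p Y a) (shift p Y b).
Proof.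
apply prec_antisym.
- apply meet_glb; apply shift_mono; [apply meet_l|apply meet_r].
- apply meet_glb; rewrite ?meet_mull, ?meet_D, ?meet_Delta; apply meet_glb.
  + apply (prec_trans (meet_l _ _)), meet_l.
  + apply (prec_trans (meet_r _ _)), meet_l.
  + apply (prec_trans (meet_l _ _)), meet_r.
  + apply (prec_trans (meet_r _ _)), meet_r.
Qed.
Lemma shift_D p Y a z : shift p Y (a * D z) = shift p Y a * D z.
Proof.
unfold shift; rewrite meet_D; f_equal; rewrite !mulgA.
- now rewrite <- !powZ_add, Z.add_comm.
- now rewrite <- (powZ_1 Δ) at 2 3; rewrite <- !powZ_add, Z.add_comm.
Qed.

Lemma iter_shift_mul p n Y a b :
  Nat.iter n (shift p Y) (a * b) = a * Nat.iter n (shift p (conj Y a)) b.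
Proof. induction n; simpl; trivial; now rewrite IHn, shift_mul. Qed.
Lemma iter_shift_mono p n Y a b :
  a <<= b -> Nat.iter n (shift p Y) a <<= Nat.iter n (shift p Y) b.
Proof. intros H; induction n; simpl; trivial; now apply shift_mono. Qed.
Lemma iter_shift_meet p n Y a b :
  Nat.iter n (shift p Y) (meet a b) =
  meet (Nat.iter n (shift p Y) a) (Nat.iter n (shift p Y) b).
Proof. induction n; simpl; trivial; now rewrite IHn, shift_meet. Qed.
Lemma iter_shift_D p n Y a z :
  Nat.iter n (shift p Y) (a * D z) = Nat.iter n (shift p Y) a * D z.
Proof. induction n; simpl; trivial; now rewrite IHn, shift_D. Qed.

(** Each application of [shift] appends the next cycling conjugator. *)
Lemma conj_iter_shift X Y a n : SSS X Y -> SSS X (conj Y a) ->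
  conj Y (Nat.iter n (shift (inf Y) Y) a) = Nat.iter n (@cyc G) (conj Y a) /\
  SSS X (conj Y (Nat.iter n (shift (inf Y) Y) a)).
Proof.
intros HY Ha; induction n as [|n [E H]]; [simpl; auto|].
simpl; rewrite <- E, shift_iota by exact (SSS_inf HY H).
rewrite <- conjM; split; [reflexivity | now apply SSS_cyc].
Qed.

Lemma iter_period (T : Type) (f : T -> T) (e : T) m k :
  Nat.iter m f e = e -> Nat.iter (k * m) f e = e.
Proof. intros H; induction k; simpl; trivial; now rewrite Nat.iter_add, IHk. Qed.

(** * Ultra summit sets and meets of conjugators *)

Lemma USS_SSS X Y : USS X Y -> SSS X Y.
Proof. now intros []. Qed.

(** For [Y] in its super summit set, the iterate at [1] is the product of the first [n] cycling
    conjugators of [Y]; its inverse times the iterate at [a] is the [n]-fold transport of [a]. *)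
Definition transported_to_itself n Y a :=
  conj Y (Nat.iter n (shift (inf Y) Y) 1) = Y /\
  Nat.iter n (shift (inf Y) Y) a = Nat.iter n (shift (inf Y) Y) 1 * a.

Lemma iter_shift_add p n m Y a : conj Y (Nat.iter n (shift p Y) 1) = Y ->
  Nat.iter n (shift p Y) a = Nat.iter n (shift p Y) 1 * a ->
  Nat.iter (m + n) (shift p Y) a = Nat.iter n (shift p Y) 1 * Nat.iter m (shift p Y) a.
Proof. intros E H; now rewrite Nat.iter_add, H, iter_shift_mul, E. Qed.

(** Used to give two conjugators a common period. *)
Lemma transported_to_itself_mul k n Y a :
  transported_to_itself n Y a -> transported_to_itself (k * n) Y a.
Proof.
intros [E H]; induction k as [|k [E' H']]; simpl.
- split; simpl; [apply conj1 | now rewrite mul1g].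
- rewrite Nat.add_comm; split.
  + rewrite iter_shift_add by (trivial; now rewrite mulg1).
    now rewrite <- conjM, E, E'.
  + rewrite !iter_shift_add, H' by (trivial; now rewrite mulg1); grp.
Qed.

Lemma iter_shift_pow p k n Y : conj Y (Nat.iter n (shift p Y) 1) = Y ->
  Nat.iter (k * n) (shift p Y) 1 = pown (Nat.iter n (shift p Y) 1) k.
Proof.
intros E; induction k; simpl; trivial.
now rewrite Nat.add_comm, iter_shift_add, IHk by (trivial; now rewrite mulg1).
Qed.

Lemma pown_add a m n : pown a (m + n) = pown a m * pown a n.
Proof. induction m; simpl; grp; now rewrite IHm. Qed.

(* The elements [c^-i * a * d^i], with [c] and [d] the products of the cycling
   conjugators along the orbits of [Y] and of [conj Y a], are transports of [a]
   and so remain in a finite interval [[1, Δ^k]]. *)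
Lemma USS_transported X Y a : Pos a -> USS X Y -> USS X (conj Y a) ->
  exists n, 0 < n /\ transported_to_itself n Y a.
Proof.
intros P [HY [m1 [L1 E1]]] [HZ [m2 [L2 E2]]].
pose (N := (m2 * m1)%nat).
assert (EY : Nat.iter N (@cyc G) Y = Y) by now apply iter_period.
assert (EZ : Nat.iter N (@cyc G) (conj Y a) = conj Y a).
{ unfold N; rewrite Nat.mul_comm; now apply iter_period. }
pose (c := Nat.iter N (shift (inf Y) Y) 1).
pose (d := Nat.iter N (shift (inf Y) (conj Y a)) 1).
assert (Cc : conj Y c = Y).
{ unfold c; destruct (@conj_iter_shift X Y 1 N) as [H _]; rewrite ?conj1; trivial.
  now rewrite H, conj1. }
assert (Cd : conj (conj Y a) d = conj Y a).
{ unfold d; rewrite <- (SSS_inf HY HZ).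
  destruct (@conj_iter_shift X (conj Y a) 1 N) as [H _]; rewrite ?conj1; trivial.
  now rewrite H, conj1. }
assert (Ec : forall i, Nat.iter (i * N) (shift (inf Y) Y) 1 = pown c i).
{ intros i; now apply iter_shift_pow. }
assert (Ed : forall i, Nat.iter (i * N) (shift (inf Y) Y) a = a * pown d i).
{ intros i; rewrite <- (mulg1 a) at 1; rewrite iter_shift_mul; f_equal.
  now apply iter_shift_pow. }
destruct (bounded_Dnat a) as [k Hk].
destruct (interval_finite k) as [l Hl].
destruct (@pigeonhole G (fun i => (pown c i)^-1 * (a * pown d i)) l) as [i [j [Lij E]]].
{ intros i; rewrite <- Ec, <- Ed; apply Hl.
  - apply prec_factor, iter_shift_mono; now apply prec1_pos.
  - apply (@prec_eq (Nat.iter (i * N) (shift (inf Y) Y) a)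
              (Nat.iter (i * N) (shift (inf Y) Y) 1 * D (Z.of_nat k))); [grp|].
    (* As [a ≼ D k], monotonicity bounds the iterate at [a] by the iterate at [D k], which is the
       iterate at [1] times [D k]. *)
    rewrite <- iter_shift_D; apply iter_shift_mono; now rewrite mul1g. }
assert (Ej : exists m, 0 < m /\ j = m + i) by (exists (j - i); lia).
destruct Ej as [m [Lm ->]].
exists (m * N)%nat; split; [unfold N; nia|].
split; rewrite Ec.
- clear -Cc; induction m; simpl; [apply conj1 | now rewrite <- conjM, Cc].
(* Cancelling [c^-i] on the left and [d^i] on the right leaves [a = c^-m * a * d^m]. *)
- rewrite Ed; rewrite !pown_add, invgM, mulgA in E; apply mulgI in E.
  apply (f_equal (fun x => x * (pown d i)^-1)) in E; rewrite !mulgA, !mulgV, !mulg1 in E.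
  transitivity (pown c m * ((pown c m)^-1 * (a * pown d m))); [grp | now rewrite <- E].
Qed.

(** After [n1 * n2] cyclings both [a] and [b] are transported to themselves. Since [shift] preserves
    meets, so is [meet a b], which makes its conjugate periodic under cycling. *)
Lemma USS_meet X Y a b : Pos a -> Pos b -> USS X Y ->
  USS X (conj Y a) -> USS X (conj Y b) -> USS X (conj Y (meet a b)).
Proof.
intros Pa Pb HY Ha Hb.
assert (HS : SSS X (conj Y (meet a b))) by (apply SSS_meet; now apply USS_SSS).
split; trivial.
destruct (USS_transported Pa HY Ha) as [n1 [L1 T1]].
destruct (USS_transported Pb HY Hb) as [n2 [L2 T2]].
exists (n1 * n2)%nat; split; [nia|].
apply (@transported_to_itself_mul n2) in T1; apply (@transported_to_itself_mul n1) in T2.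
rewrite Nat.mul_comm in T1; destruct T1 as [E1 T1], T2 as [_ T2].
destruct (@conj_iter_shift X Y (meet a b) (n1 * n2)) as [<- _]; trivial; [now apply USS_SSS|].
rewrite iter_shift_meet, T1, T2, <- meet_mull.
now rewrite <- conjM, E1.
Qed.

Lemma USS_D X Y z : USS X Y -> USS X (conj Y (D z)).
Proof.
intros [HY [m [L E]]]; split; [now apply SSS_D|]; exists m; split; trivial.
destruct (@conj_iter_shift X Y (D z) m) as [<- _]; trivial; [now apply SSS_D|].
rewrite <- (mul1g (D z)), iter_shift_D, mul1g.
destruct (@conj_iter_shift X Y 1 m) as [K _]; rewrite ?conj1; trivial.
rewrite <- conjM, K, conj1, E; reflexivity.
Qed.

Lemma USS_Delta X Y : USS X Y -> USS X (conj Y Δ).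
Proof. rewrite <- (powZ_1 Δ); apply USS_D. Qed.

Lemma USS_cyc X Y : USS X Y -> USS X (cyc Y).
Proof.
intros [HY [m [L E]]]; split; [now apply SSS_cyc|]; exists m; split; trivial.
now rewrite <- Nat.iter_succ_r, Nat.iter_succ, E.
Qed.

(** * Black and grey arrows *)

Lemma iota_pos Y : Pos (iota Y).
Proof.
rewrite iota_meet; apply meet_pos; [|apply delta_pos].
apply prec1_pos, (@prec_D (inf Y)).
rewrite mul1g, mulgA, <- powZ_add, Z.add_opp_diag_l; simpl; rewrite mulg1.
now apply prec_inf, Z.le_refl.
Qed.

Lemma iota_Delta Y : iota Y <<= Δ.
Proof. rewrite iota_meet; apply meet_r. Qed.

(** Descent to proper prefixes stops because decomposition lengths are bounded. *)
Lemma minimal_simple_exists X Y g : USS X Y -> USS X (conj Y g) ->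
  simple g -> g <> 1 -> exists s, minimal_simple X Y s /\ s <<= g.
Proof.
intros HY Hg [P L] N; apply -> prec1_pos in P.
destruct (atomic P) as [n Hn]; change (decomp_le n g) in Hn.
revert g P L N Hg Hn; induction n; intros g P L N Hg Hn.
- now apply decomp_le0 in Hn.
- destruct (classic (exists t, Pos t /\ t <<= g /\ t <> 1 /\ t <> g /\ USS X (conj Y t)))
    as [[t [Pt [Lt [Nt [Nt' Ht]]]]]|C].
  + destruct (IHn t) as [s [Hs K]]; trivial.
    * now apply (prec_trans Lt).
    * apply (@decomp_le_l n t (t^-1 * g)); [trivial| |now rewrite mulKVg].
      intros E; apply Nt'; rewrite <- (mulKVg t g), E; grp.
    * exists s; split; trivial; now apply (prec_trans K).
  + exists g; split; [|apply prec_refl].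
    split; [split; trivial; now apply prec1_pos|]; split; [trivial|]; split; [trivial|].
    intros t Pt Lt Nt Nt' Ht; apply C; exists t; split; [now apply prec1_pos|auto].
Qed.

(* [0 < ell Y] gives [Δ <<= D (sup Y - inf Y)], so that [Y * s] is bounded by
   both [s * D (sup Y)] and [Y * D (- inf Y) * D (sup Y)]. *)
Lemma black_free_grey X Y s : 0 < ell Y -> SSS X Y -> SSS X (conj Y s) ->
  simple s -> meet s (iota Y) = 1 -> s <<= iota (Y^-1).
Proof.
intros L HY Hs [_ Ls] E.
rewrite iota_meet, inf_inv, Z.opp_involutive; apply meet_glb; trivial.
assert (K : Y * s <<= D (sup Y)).
{ rewrite SSS_conj in Hs by trivial.
  apply (@prec_trans _ (meet s (Y * D (- inf Y)) * D (sup Y))).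
  - rewrite meet_D; apply meet_glb; [apply Hs|].
    rewrite mulgA, <- powZ_add; apply prec_mull, (prec_trans Ls).
    rewrite <- (powZ_1 Δ) at 1; apply D_le; unfold sup; lia.
  - rewrite <- (mul1g (D (sup Y))) at 2; apply prec_D; rewrite <- E.
    rewrite iota_meet; apply meet_glb; [apply meet_l|].
    apply meet_glb; [apply meet_r|now apply (prec_trans (meet_l _ _))]. }
revert K; apply prec_eq; grp.
Qed.

(** Monotonicity of [shift] for [Y^-1] between [1] and [s] gives [ι(Y^-1) ≼ s ι((Y^s)^-1)]. Hence a
    grey prefix stays grey after a first arrow is removed from it. *)
Lemma grey_remainder X Y s g : SSS X Y -> SSS X (conj Y s) -> Pos s ->
  g <<= iota (Y^-1) -> s^-1 * g <<= iota ((conj Y s)^-1).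
Proof.
intros HY Hs P H.
apply (@prec_eq g (s * iota ((conj Y s)^-1))); [grp|].
apply (prec_trans H).
rewrite <- conj_inv, <- (@shift_iota (inf (Y^-1))).
- rewrite <- (mul1g (iota (Y^-1))), <- (conj1 (Y^-1)), <- (@shift_iota (inf (Y^-1))) by now rewrite conj1.
  rewrite conj1; apply shift_mono; now apply prec1_pos.
- rewrite conj_inv, !inf_inv; f_equal; apply (SSS_sup HY Hs).
Qed.

Lemma grey_path_app X Y bs W gs Z :
  grey_path X Y bs W -> grey_path X W gs Z -> grey_path X Y (bs ++ gs) Z.
Proof. induction 1; simpl; trivial; constructor; auto. Qed.

Lemma conj_remainder Y s a : conj (conj Y s) (s^-1 * a) = conj Y a.
Proof. now rewrite conjM, mulKVg. Qed.

Lemma grey_path_simple X Y g : USS X Y -> USS X (conj Y g) ->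
  simple g -> g <<= iota (Y^-1) ->
  exists gs, grey_path X Y gs (conj Y g) /\ gprod gs = g.
Proof.
intros HY Hg [P L]; apply -> prec1_pos in P.
destruct (atomic P) as [n Hn]; change (decomp_le n g) in Hn.
revert Y g P L HY Hg Hn; induction n; intros Y g P L HY Hg Hn I;
  (destruct (classic (g = 1)) as [->|N]; [exists nil; rewrite conj1; split; [constructor|reflexivity]|]).
- now apply decomp_le0 in Hn.
- destruct (minimal_simple_exists HY Hg) as [s [Hs K]]; trivial;
    [split; trivial; now apply prec1_pos|].
  generalize Hs; intros [[Ps Ls] [Ns [Us _]]]; apply -> prec1_pos in Ps.
  destruct (IHn (conj Y s) (s^-1 * g)) as [gs [Hgs E]]; rewrite ?conj_remainder; trivial.
  + apply (@prec_trans _ (s^-1 * Δ)); [now apply prec_mull|].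
    apply (@prec_eq Δ (s * Δ)); [grp|].
    rewrite <- (mul1g Δ) at 1; apply prec_Delta; now apply prec1_pos.
  + now apply decomp_le_factor.
  + apply (@grey_remainder X); trivial; now apply USS_SSS.
  + rewrite conj_remainder in Hgs.
    exists (s :: gs); split; [|simpl; rewrite E; grp].
    constructor; [now split| now apply (prec_trans K)|trivial].
Qed.

Lemma meet_Delta_remainder X Y a : Pos a -> SSS X Y -> SSS X (conj Y (meet a Δ)) ->
  meet a (iota Y) = 1 ->
  meet ((meet a Δ)^-1 * a) (iota (conj Y (meet a Δ))) = 1.
Proof.
intros P HY Hg E; set (g := meet a Δ) in *.
assert (Lg : g <<= a) by apply meet_l.
(* [g * iota (conj Y g)] is simple: it precedes [g * Δ] and, by monotonicity of
   [shift], also [shift Δ = iota Y * Δ], and [g] and [iota Y] have trivial meet. *)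
assert (S : g * iota (conj Y g) <<= Δ).
{ apply (@prec_trans _ (meet g (iota Y) * Δ)).
  - rewrite meet_Delta; apply meet_glb; [apply prec_mull, iota_Delta|].
    rewrite <- (@shift_iota (inf Y)) by exact (SSS_inf HY Hg).
    apply (@prec_trans _ (shift (inf Y) Y Δ)); [apply shift_mono, meet_r|].
    generalize (shift_D (inf Y) Y 1 1); rewrite powZ_1, mul1g; intros ->.
    rewrite shift_iota by now rewrite conj1.
    rewrite conj1, mul1g; apply prec_refl.
  - rewrite <- (mul1g Δ) at 2; apply prec_Delta; rewrite <- E.
    apply meet_glb; [now apply (prec_trans (meet_l _ _))|apply meet_r]. }
apply prec1_eq; [apply meet_pos; [exact Lg|apply iota_pos]|].
(* Multiplied by [g] on the left, the meet becomes [a ∧ g ι(Y^g)], which is below [a ∧ Δ = g] by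
   [S]. *)
apply (@prec_eq (meet a (g * iota (conj Y g))) g).
- rewrite <- (mulKVg g a) at 1; rewrite <- meet_mull; grp.
- apply meet_glb; [apply meet_l|now apply (prec_trans (meet_r _ _))].
Qed.

(** Induction removing the head [a ∧ Δ]: it is grey by [black_free_grey], and [meet_Delta_remainder]
    carries the trivial meet over to the remainder. *)
Lemma grey_path_exists X Y a : 0 < ell Y -> Pos a -> USS X Y -> USS X (conj Y a) ->
  meet a (iota Y) = 1 -> exists gs, grey_path X Y gs (conj Y a) /\ gprod gs = a.
Proof.
intros L P; destruct (atomic P) as [n Hn]; change (decomp_le n a) in Hn.
revert Y a L P Hn; induction n; intros Y a L P Hn HY Ha E;
  (destruct (classic (a = 1)) as [->|N]; [exists nil; rewrite conj1; split; [constructor|reflexivity]|]).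
- now apply decomp_le0 in Hn.
- assert (Pg : Pos (meet a Δ)) by (apply meet_pos; trivial; apply delta_pos).
  assert (Hg : USS X (conj Y (meet a Δ))).
  { apply USS_meet; trivial; [apply delta_pos|now apply USS_Delta]. }
  assert (Sg : simple (meet a Δ)) by (split; [now apply prec1_pos|apply meet_r]).
  destruct (grey_path_simple HY Hg Sg) as [gs [Hgs Egs]].
  { apply (@black_free_grey X); trivial; try now apply USS_SSS.
    apply prec1_eq; [apply meet_pos; trivial; apply iota_pos|].
    rewrite <- E; apply meet_glb; [|apply meet_r].
    apply (prec_trans (meet_l _ _)), meet_l. }
  destruct (IHn (conj Y (meet a Δ)) ((meet a Δ)^-1 * a)) as [gs' [Hgs' Egs']];
    rewrite ?conj_remainder; trivial.
  + now rewrite (SSS_ell (USS_SSS HY) (USS_SSS Hg)).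
  + apply meet_l.
  + apply decomp_le_factor; trivial; now apply pos_meet_Delta_neq1.
  + apply (@meet_Delta_remainder X); trivial; now apply USS_SSS.
  + rewrite conj_remainder in Hgs'.
    exists (gs ++ gs'); split; [now apply (grey_path_app Hgs)|].
    rewrite gprod_app, Egs, Egs'; grp.
Qed.

(** Since [iota Y] conjugates [Y] to [cyc Y], [USS_meet] applies to [a ∧ ι(Y)]. If this is
    nontrivial, a minimal simple prefix of it is a black arrow dividing [a]; otherwise the rest of
    the path is grey. *)
Lemma black_grey_path_exists X Y a : 0 < ell Y -> Pos a -> USS X Y -> USS X (conj Y a) ->
  exists bs gs W, black_path X Y bs W /\ grey_path X W gs (conj Y a) /\ gprod (bs ++ gs) = a.
Proof.
intros L P; destruct (atomic P) as [n Hn]; change (decomp_le n a) in Hn.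
revert Y a L P Hn; induction n; intros Y a L P Hn HY Ha;
  (destruct (classic (meet a (iota Y) = 1)) as [E|N];
   [destruct (@grey_path_exists X Y a) as [gs [Hgs E']]; trivial;
    exists nil, gs, Y; split; [constructor|auto]|]).
- apply decomp_le0 in Hn; trivial; subst a; destruct N.
  apply prec1_eq; [apply meet_pos; [trivial|apply iota_pos]|apply meet_l].
- assert (Hm : USS X (conj Y (meet a (iota Y)))).
  { apply USS_meet; trivial; [apply iota_pos|exact (USS_cyc HY)]. }
  destruct (minimal_simple_exists HY Hm) as [s [Hs K]]; trivial.
  { split; [apply prec1_pos, meet_pos; [trivial|apply iota_pos]|].
    apply (prec_trans (meet_r _ _)), iota_Delta. }
  generalize Hs; intros [[Ps Ls] [Ns [Us _]]]; apply -> prec1_pos in Ps.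
  destruct (IHn (conj Y s) (s^-1 * a)) as [bs [gs [W [Hb [Hg E]]]]];
    rewrite ?conj_remainder; trivial.
  + now rewrite (SSS_ell (USS_SSS HY) (USS_SSS Us)).
  + apply (prec_trans K), meet_l.
  + now apply decomp_le_factor.
  + rewrite conj_remainder in Hg.
    exists (s :: bs), gs, W; split; [|split; [trivial|simpl; rewrite E; grp]].
    constructor; [now split|apply (prec_trans K), meet_r|trivial].
Qed.

(** * Positive conjugators between ultra summit elements *)

Lemma USS_power_Delta_commutes X Y : USS X Y ->
  exists e : nat, 0 < e /\ forall k : nat, conj Y (D (Z.of_nat (k * e))) = Y.
Proof.
intros HY.
destruct (interval_finite (ell Y)) as [l Hl].
(* The conjugates of [Y] by powers of [Δ] share its infimum and supremum, so dividing by [D (inf Y)]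
   on the left puts them all in the finite interval [[1, D (ell Y)]]. *)
destruct (@pigeonhole G (fun i => (D (inf Y))^-1 * conj Y (D (Z.of_nat i))) l)
  as [i [j [L E]]].
{ intros i; assert (H : SSS X (conj Y (D (Z.of_nat i)))) by now apply SSS_D, USS_SSS.
  generalize (SSS_inf (USS_SSS HY) H) (SSS_sup (USS_SSS HY) H); intros E1 E2.
  apply Hl; [apply prec_inf; lia|].
  apply (@prec_eq (conj Y (D (Z.of_nat i))) (D (sup Y))); [|apply prec_sup; lia].
  unfold sup; rewrite powZ_add; grp. }
apply mulgI in E; exists (j - i); split; [lia|].
assert (E1 : conj Y (D (Z.of_nat (j - i))) = Y).
{ rewrite Nat2Z.inj_sub by lia; unfold Z.sub.
  rewrite powZ_add, <- conjM, <- E, conjM, <- powZ_add, Z.add_opp_diag_r; apply conj1. }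
induction k; [apply conj1|].
simpl; rewrite Nat2Z.inj_add, powZ_add, <- conjM, E1; exact IHk.
Qed.

Lemma USS_pos_conj X Y Z : USS X Y -> USS X Z -> exists a, Pos a /\ Z = conj Y a.
Proof.
intros HY [[[b Hb] _] _].
destruct (USS_power_Delta_commutes HY) as [e [L E]].
destruct HY as [[[c Hc] _] _].
destruct (bounded_D (c^-1 * b)) as [n [Hn _]].
(* [c^-1 * b] conjugates [Y] to [Z] and lies above [D (-n)]. Prefixing a power of [Δ] that fixes
   [Y], with exponent at least [n], makes it positive. *)
exists (D (Z.of_nat (Z.to_nat n * e)) * (c^-1 * b)); split.
- apply prec1_pos; apply (@prec_trans _ (D (Z.of_nat (Z.to_nat n * e) + - n))).
  + apply (@D_le 0); nia.
  + apply prec_mulD; [apply prec_refl|trivial].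
- rewrite <- conjM, E; subst; grp.
Qed.

End Garside.

Theorem mainTheorem10 (G : GarsideGroup) (X Y Z : G) :
  USS X Y -> USS X Z -> 0 < ell Y ->
  (exists (bs gs : list G) (W : G),
      black_path X Y bs W /\ grey_path X W gs Z) /\
  (forall alpha : G, @Pos G alpha -> Z = conj Y alpha ->
    exists (bs gs : list G) (W : G),
      black_path X Y bs W /\ grey_path X W gs Z /\
      gprod (bs ++ gs) = alpha).
Proof.
intros HY HZ L.
(* If [Delta = one], no left normal form exists and [ell] is unspecified, but
   the group is trivial. *)
destruct (classic (@Delta G = @one G)) as [T|N].
- assert (E : forall g h : G, g = h).
  { intros g h; now rewrite (Delta_trivial T g), (Delta_trivial T h). }
  rewrite (E Z Y); split.
  + exists nil, nil, Y; split; constructor.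
  + intros alpha _ _; exists nil, nil, Y; split; [constructor|split; [constructor|apply E]].
- assert (M : forall alpha : G, @Pos G alpha -> Z = conj Y alpha ->
    exists (bs gs : list G) (W : G),
      black_path X Y bs W /\ grey_path X W gs Z /\ gprod (bs ++ gs) = alpha).
  { intros alpha P ->; now apply black_grey_path_exists. }
  split; [|exact M].
  destruct (USS_pos_conj N HY HZ) as [a [P E]].
  destruct (M a P E) as [bs [gs [W [Hb [Hg _]]]]]; now exists bs, gs, W.
Qed.
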